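(* Let $(X,d_X,\le_X,\ll_X,\tau_X)$ and $(Y,d_Y,\le_Y,\ll_Y,\tau_Y)$ be Lorentzian pre-length spaces, let $A\subseteq X$, $\lambda>0$ and $N\ge 0$. Let $f:X\to Y$ be a map satisfying the following, where for $\epsilon>0$ we write $A_\epsilon:=\{x\in X \mid d_X(x,A)\le\epsilon\}$: (1) there exists $\epsilon>0$ such that $f$ is uniformly continuous with respect to $d_X$ and $d_Y$ on $A_\epsilon$; (2) (for this $\epsilon$) $f$ is timelike $\lambda$-Lipschitz with respect to $\tau_X$ and $\tau_Y$ on $A_\epsilon$; (3) $f$ is surjective; (4) $f$ dually preserves the causal relation, i.e. for all $p,q\in X$, $p\le_X q \Leftrightarrow f(p)\le_Y f(q)$. Then $\mathcal V^N(f(A))\le\lambda^N\,\mathcal V^N(A)$, where $\mathcal V^N$ denotes the $N$-dimensional timelike Hausdorff measure on $Y$ and on $X$, respectively.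
   Context: A Lorentzian pre-length space $(X,d,\le,\ll,\tau)$ is a metric space $(X,d)$ with a reflexive and transitive relation $\le$ (causal relation), a transitive relation $\ll$ (timelike relation) contained in $\le$, and a function $\tau:X\times X\to[0,\infty]$ (time separation), lower semi-continuous for the topology induced by $d$, such that $\tau(x,z)\ge\tau(x,y)+\tau(y,z)$ whenever $x\le y\le z$; $\tau(x,y)=0$ if $x\not\le y$; and $\tau(x,y)>0$ if and only if $x\ll y$. We write $x<y$ if $x\le y$ and $x\ne y$. For $p,q\in X$ put $J^+(p)=\{y\mid p\le y\}$, $J^-(q)=\{y\mid y\le q\}$, $J(p,q)=J^+(p)\cap J^-(q)$ (causal diamond). Let $\mathcal J:=\{J(p,q)\mid p,q\in X,\ p<q\}\cup\{\emptyset\}$. For $N\ge0$ put $\rho_N(J(p,q)):=\omega_N\,\tau(p,q)^N$ (and $:=\infty$ if $\tau(p,q)=\infty$), $\rho_N(\emptyset):=0$, where $\omega_N=\frac{\pi^{(N-1)/2}}{N\,\Gamma((N+1)/2)\,2^{N-1}}$ for $N>0$ ($\Gamma$ the Euler gamma function), and for $N=0$, $\omega_0$ is a fixed positive constant with $0^0=1$. Timelike Hausdorff measure: for $A\subseteq X$, $\delta>0$, $$\mathcal V^N_\delta(A):=\inf\Big\{\sum_{i=1}^\infty\rho_N(A_i)\ \Big|\ A_i\in\mathcal J,\ \mathrm{diam}_d(A_i)<\delta,\ A\subseteq\bigcup_{i=1}^\infty A_i\Big\},\qquad \inf\emptyset=\infty,$$ and $\mathcal V^N(A):=\sup_{\delta>0}\mathcal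 V^N_\delta(A)$. Timelike Lipschitz: for $\lambda>0$ and $S\subseteq X$, $f:X\to Y$ is timelike $\lambda$-Lipschitz on $S$ if $\tau_Y(f(p),f(q))\le\lambda\,\tau_X(p,q)$ for all $p,q\in S$ (in particular $f(p)\ll f(q)$ implies $p\ll q$ for $p,q\in S$). *)

(* Defs.v *)
From HB Require Import structures.
From mathcomp Require Import all_boot all_order all_algebra.
From mathcomp Require Import all_classical all_reals all_analysis.

Set Implicit Arguments.
Unset Strict Implicit.
Unset Printing Implicit Defensive.

Import Order.TTheory GRing.Theory Num.Theory.
Import numFieldNormedType.Exports.

Local Open Scope classical_set_scope.
Local Open Scope ring_scope.

HB.mixin Record Metric_isLorentzianPreLength (R : realType) X & Metric R X := {
  causal : X -> X -> Prop ;
  timelike : X -> X -> Prop ;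
  tau : X -> X -> \bar R ;
  causal_refl : forall x, causal x x ;
  causal_trans : forall x y z, causal x y -> causal y z -> causal x z ;
  timelike_trans : forall x y z,
    timelike x y -> timelike y z -> timelike x z ;
  timelike_causal : forall x y, timelike x y -> causal x y ;
  tau_ge0 : forall x y, (0 <= tau x y)%E ;
  tau_lsc : lower_semicontinuous (fun xy : X * X => tau xy.1 xy.2) ;
  tau_reverse_triangle : forall x y z, causal x y -> causal y z ->
    (tau x y + tau y z <= tau x z)%E ;
  tau_eq0 : forall x y, ~ causal x y -> tau x y = 0%E ;
  tau_gt0 : forall x y, (0 < tau x y)%E <-> timelike x y
}.

#[short(type="lorentzianPreLengthType")]
HB.structure Definition LorentzianPreLength (R : realType) :=
  { X of Metric R X & Metric_isLorentzianPreLength R X }.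

Notation "x <=c y" := (causal x y) (at level 70, y at next level).
Notation "x <<t y" := (timelike x y) (at level 70, y at next level).
Notation "x <c y" := (causal x y /\ x <> y) (at level 70, y at next level).

Section metric_notions.
Context {R : realType}.

(* The maximum with 0 only matters for the empty set, whose supremum of
   distances is -oo in [\bar R]. *)
Definition diam {X : metricType R} (S : set X) : \bar R :=
  maxe 0%E (ereal_sup [set (mdist xy.1 xy.2)%:E | xy in S `*` S]).

(* The infimum over the empty set is +oo, so the thickening of set0 is set0. *)
Definition thickening {X : metricType R} (A : set X) (e : R) : set X :=
  [set x | (ereal_inf [set (mdist x a)%:E | a in A] <= e%:E)%E].

Definition unif_continuous_on {X Y : metricType R} (S : set X) (f : X -> Y) :=
  unif_continuous (f : subspace S -> Y).

Lemma unif_continuous_onP {X Y : metricType R} (S : set X) (f : X -> Y) :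
  unif_continuous_on S f <->
  forall e : R, 0 < e -> exists2 d : R, 0 < d &
    forall x y, S x -> S y -> mdist x y < d -> mdist (f x) (f y) < e.
Proof.
rewrite /unif_continuous_on /unif_continuous; split=> [fS e e0|fS E].
- have eY : entourage [set xy : Y * Y | ball xy.1 e xy.2].
    by rewrite -entourage_ballE; exists e.
  have [E + ES] := fS _ eY; rewrite -entourage_ballE => -[d d0 dE].
  exists d => // x y Sx Sy xyd; have : E (x, y).
    by apply: dE; rewrite /= ballEmdist.
  move=> Exy; have := ES (x, y) (or_intror (conj Sx (conj Sy Exy))).
  by rewrite /= ballEmdist.
- rewrite -entourage_ballE => -[e e0 eE]; have [d d0 dS] := fS _ e0.
  exists [set xy | ball xy.1 d xy.2]; first by rewrite -entourage_ballE; exists d.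
  move=> [x y] /= [<-|[Sx [Sy]]]; first by apply: eE; exact: ballxx.
  by rewrite ballEmdist => /= xyd; apply: eE; rewrite /= ballEmdist; exact: dS.
Qed.

End metric_notions.

Section diamonds.
Context {R : realType} {X : lorentzianPreLengthType R}.
Implicit Types p q : X.

Definition Jplus p : set X := [set y | p <=c y].
Definition Jminus q : set X := [set y | y <=c q].
Definition diamond p q : set X := Jplus p `&` Jminus q.

Definition diamonds : set (set X) :=
  [set S | exists p q, p <c q /\ S = diamond p q] `|` [set set0].

End diamonds.

Section volume.
Context {R : realType}.

Definition Gamma (x : R) : R :=
  \int[lebesgue_measure]_(t in `]0, +oo[) (t `^ (x - 1) * expR (- t)).

(* [w0] is the constant chosen for N = 0. *)
Definition omega (w0 N : R) : R :=
  if N == 0 then w0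
  else pi `^ ((N - 1) / 2) / (N * Gamma ((N + 1) / 2) * 2 `^ (N - 1)).

Context {X : lorentzianPreLengthType R}.

(* The value +oo is singled out because [+oo `^ 0 = 1]; for finite values,
   [0 `^ 0 = 1]. *)
Definition diamond_weight (w0 N : R) (p q : X) : \bar R :=
  if tau p q == +oo%E then +oo%E else ((omega w0 N)%:E * tau p q `^ N)%E.

(* A diamond may have several pairs of endpoints, all of the same weight: see
   [rhoE]. *)
Definition rho (w0 N : R) (S : set X) : \bar R :=
  if S == set0 then 0%E
  else ereal_inf [set w | exists p q,
    [/\ p <c q, S = diamond p q & w = diamond_weight w0 N p q]].

Lemma rho_set0 (w0 N : R) : rho w0 N set0 = 0%E.
Proof. by rewrite /rho eqxx. Qed.

Lemma diamond_left (p q : X) : p <=c q -> diamond p q p.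
Proof. by move=> pq; split => //; exact: causal_refl. Qed.

Lemma diamond_right (p q : X) : p <=c q -> diamond p q q.
Proof. by move=> pq; split => //; exact: causal_refl. Qed.

Lemma le_tau_diamond (p q p' q' : X) : p' <=c q' ->
  diamond p' q' `<=` diamond p q -> (tau p' q' <= tau p q)%E.
Proof.
move=> p'q' sub.
have [pp' _] : diamond p q p' by apply: sub; exact: diamond_left.
have [_ q'q] : diamond p q q' by apply: sub; exact: diamond_right.
have pq' : p <=c q' by exact: causal_trans p'q'.
apply: (@le_trans _ _ (tau p q')).
  apply: le_trans (tau_reverse_triangle p p' q' pp' p'q').
  by rewrite leeDr// tau_ge0.
apply: le_trans (tau_reverse_triangle p q' q pq' q'q).
by rewrite leeDl// tau_ge0.
Qed.

Lemma rhoE (w0 N : R) (p q : X) : p <c q ->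
  rho w0 N (diamond p q) = diamond_weight w0 N p q.
Proof.
move=> pq; rewrite /rho ifF; last first.
  by apply/negbTE/set0P; exists p; apply: diamond_left; case: pq.
rewrite [X in ereal_inf X](_ : _ = [set diamond_weight w0 N p q]) ?ereal_inf1//.
apply/seteqP; split=> [w [p' [q' [p'q' E ->]]]|w ->] /=; last by exists p, q.
rewrite /diamond_weight; suff -> : tau p' q' = tau p q by [].
apply/eqP; rewrite eq_le !le_tau_diamond// -?E//; [exact: pq.1|exact: p'q'.1].
Qed.

Definition hausdorff_pre (w0 N : R) (delta : R) (A : set X) : \bar R :=
  ereal_inf [set (\sum_(0 <= i <oo) rho w0 N (S i))%E | S in
    [set S : (set X)^nat |
      [/\ forall i, diamonds (S i),
          forall i, (diam (S i) < delta%:E)%E &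
          A `<=` \bigcup_i S i]]].

Definition hausdorff (w0 N : R) (A : set X) : \bar R :=
  ereal_sup [set hausdorff_pre w0 N delta A | delta in [set d : R | 0 < d]].

End volume.

Definition timelike_lipschitz_on {R : realType} {X Y : lorentzianPreLengthType R}
    (lambda : R) (S : set X) (f : X -> Y) :=
  forall p q, S p -> S q -> (tau (f p) (f q) <= lambda%:E * tau p q)%E.

(* Main.v *)
(** A diamond of small diameter meeting [A] lies in the thickening of [A], and
    surjectivity with dual preservation of [<=] makes its image the diamond
    J(f p, f q), of small diameter and of weight at most lambda^N times the
    original one.  Discarding the diamonds that miss [A], a cover of [A] is thus
    pushed forward to a cover of [f @` A].

    The image is a degenerate diamond when f p = f q, which forces p <= q <= p.
    A diamond contains the whole causal equivalence class of each of its points;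
    so if some point of [A] has a nontrivial class, then [A] has no cover by
    diamonds smaller than this class and its measure is infinite.  Otherwise no
    diamond meeting [A] degenerates. *)
Require Import Defs.
From mathcomp Require Import all_boot all_order all_algebra.
From mathcomp Require Import all_classical all_reals all_analysis.

Set Implicit Arguments.
Unset Strict Implicit.

Import Order.TTheory GRing.Theory Num.Theory.

Local Open Scope classical_set_scope.
Local Open Scope ring_scope.

Section metric.
Context {R : realType} {X : metricType R}.

Lemma mdist_le_diam (S : set X) (x y : X) :
  S x -> S y -> ((mdist x y)%:E <= diam S)%E.
Proof.
move=> Sx Sy; rewrite /diam le_max; apply/orP; right.
by apply: ereal_sup_ubound; exists (x, y).
Qed.

Lemma diam_le (S : set X) (e : R) : 0 <= e ->
  (forall x y, S x -> S y -> mdist x y <= e) -> (diam S <= e%:E)%E.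
Proof.
move=> e0 Se; rewrite /diam ge_max lee_fin e0 /=.
by apply: ge_ereal_sup => _ [[x y] [Sx Sy] <-]; rewrite lee_fin; exact: Se.
Qed.

Lemma subset_thickening (A S : set X) (e : R) :
  A `&` S !=set0 -> (diam S <= e%:E)%E -> S `<=` thickening A e.
Proof.
move=> [a [Aa Sa]] Se x Sx; rewrite /thickening /=; apply: le_trans Se.
apply: le_trans (mdist_le_diam Sx Sa).
by apply: ereal_inf_lbound; exists a.
Qed.

End metric.

Section weight.
Context {R : realType}.

Lemma Gamma_ge0 (x : R) : 0 <= Gamma x.
Proof. by apply: Rintegral_ge0 => t _; rewrite mulr_ge0 ?powR_ge0 ?expR_ge0. Qed.

Lemma omega_ge0 (w0 N : R) : 0 <= w0 -> 0 <= N -> 0 <= omega w0 N.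
Proof.
move=> w00 N0; rewrite /omega; case: ifP => // _.
by rewrite divr_ge0 ?mulr_ge0 ?powR_ge0 ?Gamma_ge0.
Qed.

Context {X : lorentzianPreLengthType R} (w0 N : R).
Hypotheses (w00 : 0 <= w0) (N0 : 0 <= N).

Lemma diamond_weight_ge0 (p q : X) : (0 <= diamond_weight w0 N p q)%E.
Proof.
rewrite /diamond_weight; case: ifP => // _.
by rewrite mule_ge0 ?poweR_ge0// lee_fin omega_ge0.
Qed.

Lemma rho_ge0 (S : set X) : (0 <= rho w0 N S)%E.
Proof.
rewrite /rho; case: ifP => // _; apply: le_ereal_inf_tmp => _ [p [q [_ _ ->]]].
exact: diamond_weight_ge0.
Qed.

(** If [tau p q] is infinite, so is the right-hand side. Otherwise [tau p' q'] is finite too, and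
    the claim is monotonicity of [t ^ N]. *)
Lemma diamond_weight_scale {Y : lorentzianPreLengthType R} (lambda : R)
    (p q : X) (p' q' : Y) :
  0 < lambda -> (tau p' q' <= lambda%:E * tau p q)%E ->
  (diamond_weight w0 N p' q' <= (lambda `^ N)%:E * diamond_weight w0 N p q)%E.
Proof.
move=> l0 le_tau; rewrite {2}/diamond_weight; case: ifPn => [_|tauy].
  (* Positivity of [lambda ^ N] excludes the product of 0 and [+oo], which would be 0. *)
  by rewrite gt0_muley ?leey// lte_fin powR_gt0.
have tau_fin : tau p q \is a fin_num.
  by rewrite ge0_fin_numE ?tau_ge0// ltey.
have tau'_lty : (tau p' q' < +oo)%E.
  by apply: le_lt_trans le_tau _; rewrite -(fineK tau_fin) -EFinM ltry.
rewrite /diamond_weight lt_eqF// muleCA -poweR_EFin.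
rewrite -poweRM ?lee_fin ?(ltW l0) ?tau_ge0//.
apply: lee_wpmul2l; first by rewrite lee_fin omega_ge0.
apply: gt0_ler_poweR => //; rewrite in_itv /= leey andbT ?tau_ge0//.
by rewrite mule_ge0 ?tau_ge0// lee_fin ltW.
Qed.

Lemma hausdorff_causal_loop (A : set X) (a c : X) :
  A a -> a <c c -> c <=c a -> hausdorff w0 N A = +oo%E.
Proof.
move=> Aa [ac /eqP a_neq_c] ca; apply: ereal_supy.
(* At this scale no cover is admissible: the member containing [a] also contains [c], so its
   diameter is not strictly below [mdist a c]. *)
exists (mdist a c); first by rewrite /= mdist_gt0.
rewrite /hausdorff_pre [X in ereal_inf X](_ : _ = set0) ?ereal_inf0//.
rewrite -subset0 => t [S [dS diamS AS] _].
have [i _ Sia] := AS _ Aa; have := diamS i; apply/negP; rewrite -leNgt.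
apply: mdist_le_diam => //; case: (dS i) Sia => [[p [q [_ ->]]]|-> //].
by move=> [pa aq]; split; [exact: causal_trans pa ac|exact: causal_trans ca aq].
Qed.

End weight.

Section pushforward.
Context {R : realType} {X Y : lorentzianPreLengthType R} (f : X -> Y).
Hypotheses (f_surj : set_surj [set: X] [set: Y] f)
  (f_causal : forall p q : X, p <=c q <-> f p <=c f q).

Lemma image_diamond (p q : X) : f @` diamond p q = diamond (f p) (f q).
Proof.
apply/seteqP; split => [_ [x [px xq] <-]|y [py yq]].
  by split; apply/f_causal.
(* Surjectivity provides a preimage, and reflection of the causal relation places it in the
   diamond. *)
have [x _ fx] := f_surj (I : [set: Y] y); rewrite -fx in py yq *.
by exists x => //; split; apply/f_causal.
Qed.

Variables (A : set X) (lambda N w0 eps : R).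
Hypotheses (lambda_gt0 : 0 < lambda) (N_ge0 : 0 <= N) (w0_ge0 : 0 <= w0)
  (f_lip : timelike_lipschitz_on lambda (thickening A eps) f).
Hypothesis A_noloop : forall a c, A a -> a <=c c -> c <=c a -> a = c.

Lemma image_diamond_rho (S : set X) :
  diamonds S -> A `&` S !=set0 -> (diam S <= eps%:E)%E ->
  diamonds (f @` S) /\
  (rho w0 N (f @` S) <= (lambda `^ N)%:E * rho w0 N S)%E.
Proof.
move=> [[p [q [pq SE]]]|->]; last by rewrite setI0 => -[].
move=> AS Seps; have sub := subset_thickening AS Seps.
have fpq : f p <c f q.
  split; first exact/f_causal/pq.1.
  (* Then [p], [q] and a point [a] of [A] between them are causally equivalent, so [A_noloop] at [a]
     forces [p = a = q]. *)
  move=> fpq; have qp : q <=c p by apply/f_causal; rewrite fpq; exact: causal_refl.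
  case: AS => a []; rewrite SE => Aa [pa aq]; apply: pq.2.
  have <- : a = p by apply: A_noloop => //; exact: causal_trans aq qp.
  by apply: A_noloop => //; exact: causal_trans qp pa.
rewrite SE image_diamond; split; first by left; exists (f p), (f q).
rewrite !rhoE//; apply: diamond_weight_scale => //.
(* The Lipschitz bound applies because the endpoints belong to the diamond, hence to the
   thickening. *)
by apply: f_lip; apply: sub; rewrite SE; [apply: diamond_left|apply: diamond_right];
  exact: pq.1.
Qed.

Hypotheses (eps_gt0 : 0 < eps) (f_unif : unif_continuous_on (thickening A eps) f).

(** The scale [r] may depend on [delta], since [hausdorff] is a supremum over all scales. *)
Lemma hausdorff_pre_image (delta : R) : 0 < delta ->
  exists2 r : R, 0 < r &
  (hausdorff_pre w0 N delta (f @` A) <=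
   (lambda `^ N)%:E * hausdorff_pre w0 N r A)%E.
Proof.
(* Pairwise bounds only give a weak bound on the diameter; halving [delta] makes it strict. *)
move=> delta0; have d20 : 0 < delta / 2 by rewrite divr_gt0.
have [e e0 fe] := (unif_continuous_onP _ _).1 f_unif _ d20.
(* The bound [e] controls the diameters of the images, and [eps] keeps the diamonds meeting [A]
   inside the thickening. *)
exists (Num.min e eps); first by rewrite lt_min e0.
rewrite -lee_pdivrMl ?powR_gt0//.
apply: le_ereal_inf_tmp => _ [S [dS diamS AS] <-].
rewrite lee_pdivrMl ?powR_gt0//.
have diamSe i : (diam (S i) < e%:E)%E.
  by apply: lt_le_trans (diamS i) _; rewrite lee_fin ge_min lexx.
have diamSeps i : (diam (S i) <= eps%:E)%E.
  by apply: ltW; apply: lt_le_trans (diamS i) _; rewrite lee_fin ge_min lexx orbT.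
(* A diamond missing [A] becomes [set0], an admissible member of weight 0, so the indexing is
   kept. *)
pose T i := if `[< A `&` S i !=set0 >] then f @` S i else set0.
have le_rho i : (rho w0 N (T i) <= (lambda `^ N)%:E * rho w0 N (S i))%E.
  rewrite /T; case: asboolP => [ASi|_].
    exact: (image_diamond_rho (dS i) ASi (diamSeps i)).2.
  by rewrite rho_set0 mule_ge0 ?lee_fin ?powR_ge0 ?rho_ge0.
apply: ge_ereal_inf; exists (\sum_(0 <= i <oo) rho w0 N (T i))%E; last first.
  rewrite -nneseriesZl; last by move=> i _; exact: rho_ge0.
  by apply: lee_nneseries => [i _ _|i _]; [exact: rho_ge0|exact: le_rho].
exists T => //; split=> [i|i|_ [a Aa <-]].
- rewrite /T; case: asboolP => [ASi|_]; last by right.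
  exact: (image_diamond_rho (dS i) ASi (diamSeps i)).1.
- apply: (@le_lt_trans _ _ (delta / 2)%:E); last first.
    by rewrite lte_fin ltr_pdivrMr// ltr_pMr// ltr1n.
  apply: diam_le; first exact: ltW.
  rewrite /T; case: asboolP => // ASi _ _ [x Sx <-] [y Sy <-].
  have sub := subset_thickening ASi (diamSeps i).
  apply/ltW/fe; [exact: sub|exact: sub|].
  by rewrite -lte_fin; apply: le_lt_trans (diamSe i); exact: mdist_le_diam.
- have [i _ Sia] := AS _ Aa; exists i => //; rewrite /T asboolT; last by exists a.
  by exists a.
Qed.

End pushforward.

Theorem theorem1p3 (R : realType) (X Y : lorentzianPreLengthType R)
    (A : set X) (lambda N w0 : R) (f : X -> Y) :
  0 < lambda -> 0 <= N -> 0 < w0 ->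
  (exists2 eps : R, 0 < eps &
     unif_continuous_on (thickening A eps) f /\
     timelike_lipschitz_on lambda (thickening A eps) f) ->
  set_surj [set: X] [set: Y] f ->
  (forall p q : X, p <=c q <-> f p <=c f q) ->
  (hausdorff w0 N (f @` A) <= (lambda `^ N)%:E * hausdorff w0 N A)%E.
Proof.
move=> l0 N0 /ltW w00 [eps eps0 [fu fl]] fs fc.
have [noloop|] := pselect (forall a c, A a -> a <=c c -> c <=c a -> a = c).
  apply: ge_ereal_sup => _ [delta delta0 <-].
  have [r r0 le_pre] :=
    hausdorff_pre_image fs fc l0 N0 w00 fl noloop eps0 fu delta0.
  apply: le_trans le_pre _; apply: lee_wpmul2l; first by rewrite lee_fin powR_ge0.
  by apply: ereal_sup_ubound; exists r.
(* With a causal loop through [A], the right-hand side is [+oo]. *)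
move=> /existsNP[a] /existsNP[c] /not_implyP[Aa] /not_implyP[ac].
move=> /not_implyP[ca a_neq_c].
rewrite (hausdorff_causal_loop w0 N Aa (conj ac a_neq_c) ca).
by rewrite gt0_muley ?leey// lte_fin powR_gt0.
Qed.
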